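(* Let $\mathscr{C}$ be a fiab bicategory. For two indecomposable $1$-morphisms $\mathrm{F}$ and $\mathrm{G}$ in $\mathscr{C}$, the following conditions are equivalent: (a) $\mathrm{F}\leq_R\mathrm{G}$. (b) $\mathscr{J}_{\mathrm{G}}\subseteq\mathscr{J}_{\mathrm{F}}$.
   Context: All categories are $\mathbb{C}$-linear. A finitary category is an additive, idempotent split, $\mathbb{C}$-linear category with finitely many isomorphism classes of indecomposable objects and finite dimensional morphism spaces. A finitary bicategory $\mathscr{C}$ is a bicategory with finitely many objects such that each $\mathscr{C}(\mathtt{i},\mathtt{j})$ is a finitary category, horizontal composition is biadditive and bilinear, and each identity $1$-morphism $\mathbbm{1}_{\mathtt{i}}$ is indecomposable. A fiab bicategory is a finitary bicategory with a weak involution $\star$ (object-preserving, reversing the direction of both $1$- and $2$-morphisms) together with adjunction $2$-morphisms making $(\mathrm{F},\mathrm{F}^\star)$ an adjoint pair for every $1$-morphism $\mathrm{F}$. On the set $\mathcal{S}(\mathscr{C})$ of isomorphism classes of indecomposable $1$-morphisms, the right pre-order is defined by: $\mathrm{F}\leq_R\mathrm{G}$ if there is a $1$-morphism $\mathrm{H}$ such that $\mathrm{G}$ is isomorphic to a direct summand of $\mathrm{F}\mathrm{H}$ (i.e. $\mathrm{F}\circ\mathrm{H}$). For an object $\mathtt{i}$, the principal birepresentation is $\mathbf{P}_{\mathtt{i}}=\mathscr{C}(\mathtt{i},{}_-)$, so $\mathbf{P}_{\mathtt{i}}(\mathtt{j})=\mathscr{C}(\mathtt{i},\mathtt{j})$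 with $\mathscr{C}$ acting by left composition. Its (projective) abelianization $\overline{\mathbf{P}}_{\mathtt{i}}$ is the abelian birepresentation in which $\overline{\mathbf{P}}_{\mathtt{i}}(\mathtt{j})$ is an abelian category whose category of projective objects is equivalent to $\mathscr{C}(\mathtt{i},\mathtt{j})$ (objects are morphisms $X\to Y$ in $\mathscr{C}(\mathtt{i},\mathtt{j})$, thought of as presentations of cokernels), with the induced action of $\mathscr{C}$. For an indecomposable $\mathrm{F}\in\mathscr{C}(\mathtt{i},\mathtt{j})$, $L_{\mathrm{F}}\in\overline{\mathbf{P}}_{\mathtt{i}}(\mathtt{j})$ is the simple top of the indecomposable projective object corresponding to $\mathrm{F}$. Its annihilator $\mathscr{J}_{\mathrm{F}}$ in $\mathscr{C}$ is the left biideal consisting of all $2$-morphisms $\alpha$ in $\mathscr{C}$ such that the evaluation $\overline{\mathbf{P}}_{\mathtt{i}}(\alpha)_{L_{\mathrm{F}}}$ is zero; here $2$-morphisms between $1$-morphisms whose domain object differs from $\mathtt{j}$ are regarded as evaluating to zero on $L_{\mathrm{F}}$. *)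

(* Defs.v *)
From HB Require Import structures.
From mathcomp Require Import all_boot all_order all_algebra.
From mathcomp Require Import complex reals.

Set Implicit Arguments.
Unset Strict Implicit.
Unset Printing Implicit Defensive.

Import GRing.Theory.
Local Open Scope ring_scope.

Declare Scope bicat_scope.
Delimit Scope bicat_scope with bicat.

(* The finite dimensionality of the morphism spaces is carried by [vectType]. *)
Record lincat (K : fieldType) := LinCat {
  lob :> Type;
  mor : lob -> lob -> vectType K;
  idm : forall X, mor X X;
  cmp : forall X Y Z, mor Y Z -> mor X Y -> mor X Z;
  cmpA : forall X Y Z T (h : mor Z T) (g : mor Y Z) (f : mor X Y),
    cmp h (cmp g f) = cmp (cmp h g) f;
  cmp1m : forall X Y (f : mor X Y), cmp (idm Y) f = f;
  cmpm1 : forall X Y (f : mor X Y), cmp f (idm X) = f;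
  cmp_linr : forall X Y Z (g : mor Y Z), linear (fun f : mor X Y => cmp g f);
  cmp_linl : forall X Y Z (f : mor X Y), linear (fun g : mor Y Z => cmp g f)
}.

Arguments mor {K l} X Y.
Arguments idm {K l} X.
Arguments cmp {K l X Y Z} g f.

Notation "g \v f" := (cmp g f) (at level 40, left associativity) : bicat_scope.
Local Open Scope bicat_scope.

Lemma cmp0m (K : fieldType) (A : lincat K) (X Y Z : A) (f : mor X Y) :
  (0 : mor Y Z) \v f = 0.
Proof.
by have := cmp_linl f (-1) (0 : mor Y Z) 0;
  rewrite scaler0 addr0 scaleN1r addNr.
Qed.

Lemma cmpm0 (K : fieldType) (A : lincat K) (X Y Z : A) (g : mor Y Z) :
  g \v (0 : mor X Y) = 0.
Proof.
by have := cmp_linr g (-1) (0 : mor X Y) 0;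
  rewrite scaler0 addr0 scaleN1r addNr.
Qed.

Record iso (K : fieldType) (A : lincat K) (X Y : A) := Iso {
  ifwd :> mor X Y;
  ibwd : mor Y X;
  iso_bf : ibwd \v ifwd = idm X;
  iso_fb : ifwd \v ibwd = idm Y
}.

Section CategoryNotions.
Variables (K : fieldType) (A : lincat K).

Definition isomorphic (X Y : A) : Prop := inhabited (iso X Y).

Definition is_zero (X : A) : Prop := idm X = 0.

Definition is_dsum (S X Y : A) : Prop :=
  exists (i1 : mor X S) (i2 : mor Y S) (p1 : mor S X) (p2 : mor S Y),
    [/\ p1 \v i1 = idm X, p2 \v i2 = idm Y, p1 \v i2 = 0, p2 \v i1 = 0
      & i1 \v p1 + i2 \v p2 = idm S].

(* Up to isomorphism: [is_dsum S X Y] does not require [X] to be a subobject  *)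
(* fixed in advance.                                                          *)
Definition summand (X S : A) : Prop := exists Y : A, is_dsum S X Y.

Definition indecomposable (S : A) : Prop :=
  ~ is_zero S /\ forall X Y : A, is_dsum S X Y -> is_zero X \/ is_zero Y.

Definition idem_split : Prop :=
  forall (X : A) (e : mor X X), e \v e = e ->
    exists (Y : A) (r : mor X Y) (s : mor Y X), r \v s = idm Y /\ s \v r = e.

Definition fin_indec : Prop :=
  exists (n : nat) (T : 'I_n -> A),
    forall X : A, indecomposable X -> exists k, isomorphic X (T k).

End CategoryNotions.

Record fincat (K : fieldType) := FinCat {
  fincat_lincat :> lincat K;
  zob : fincat_lincat;
  zobP : is_zero zob;
  dsum_ex : forall X Y : fincat_lincat, exists S : fincat_lincat, is_dsum S X Y;
  fincat_split : idem_split fincat_lincat;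
  fincat_fin : fin_indec fincat_lincat
}.

Arguments zob {K f}.

(* Composition of 1-morphisms is written [F \c G] (first [G], then [F]);      *)
(* [a \h b] is horizontal and [a \v b] vertical composition of 2-morphisms.   *)
(* Bilinearity of [\h] makes [\c] biadditive, since biproducts are preserved  *)
(* by linear functors.                                                        *)
Record finbicat (K : fieldType) := FinBicat {
  bob :> finType;
  bhom : bob -> bob -> fincat K;
  one : forall i : bob, bhom i i;
  bcmp : forall i j k : bob, bhom j k -> bhom i j -> bhom i k;
  hcmp : forall (i j k : bob) (F F' : bhom j k) (G G' : bhom i j),
    mor F F' -> mor G G' -> mor (bcmp F G) (bcmp F' G');
  hcmp1 : forall (i j k : bob) (F : bhom j k) (G : bhom i j),
    hcmp (idm F) (idm G) = idm (bcmp F G);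
  hcmp_v : forall (i j k : bob) (F F' F'' : bhom j k) (G G' G'' : bhom i j)
    (a' : mor F' F'') (a : mor F F') (b' : mor G' G'') (b : mor G G'),
    hcmp (a' \v a) (b' \v b) = hcmp a' b' \v hcmp a b;
  hcmp_linl : forall (i j k : bob) (F F' : bhom j k) (G G' : bhom i j)
    (b : mor G G'), linear (fun a : mor F F' => hcmp a b);
  hcmp_linr : forall (i j k : bob) (F F' : bhom j k) (G G' : bhom i j)
    (a : mor F F'), linear (fun b : mor G G' => hcmp a b);
  assoc : forall (i j k l : bob)
    (F : bhom k l) (G : bhom j k) (H : bhom i j),
    iso (bcmp (bcmp F G) H) (bcmp F (bcmp G H));
  lunit : forall (i j : bob) (F : bhom i j), iso (bcmp (one j) F) F;
  runit : forall (i j : bob) (F : bhom i j), iso (bcmp F (one i)) F;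
  assoc_nat : forall (i j k l : bob) (F F' : bhom k l) (G G' : bhom j k)
    (H H' : bhom i j) (a : mor F F') (b : mor G G') (c : mor H H'),
    assoc F' G' H' \v hcmp (hcmp a b) c = hcmp a (hcmp b c) \v assoc F G H;
  lunit_nat : forall (i j : bob) (F F' : bhom i j) (a : mor F F'),
    lunit F' \v hcmp (idm (one j)) a = a \v lunit F;
  runit_nat : forall (i j : bob) (F F' : bhom i j) (a : mor F F'),
    runit F' \v hcmp a (idm (one i)) = a \v runit F;
  pentagon : forall (i j k l m : bob) (F : bhom l m) (G : bhom k l)
    (H : bhom j k) (L : bhom i j),
    assoc F G (bcmp H L) \v assoc (bcmp F G) H L
    = hcmp (idm F) (assoc G H L) \v assoc F (bcmp G H) L
        \v hcmp (assoc F G H) (idm L);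
  triangle : forall (i j k : bob) (F : bhom j k) (G : bhom i j),
    hcmp (idm F) (lunit G) \v assoc F (one j) G = hcmp (runit F) (idm G);
  one_indec : forall i : bob, indecomposable (one i)
}.

Arguments bhom {K f} i j.
Arguments one {K f} i.
Arguments bcmp {K f i j k} F G.
Arguments hcmp {K f i j k F F' G G'} a b.
Arguments assoc {K f i j k l} F G H.
Arguments lunit {K f i j} F.
Arguments runit {K f i j} F.

Notation "F \c G" := (bcmp F G) (at level 39, left associativity) : bicat_scope.
Notation "a \h b" := (hcmp a b) (at level 39, left associativity) : bicat_scope.

(* The fields from [star] to [sunit_r] make [star] a pseudofunctor from [C]   *)
(* to its bicategory with 1- and 2-morphisms reversed, identity on objects;   *)
(* those from [sinv] to [sinv_one] make [sinv] an invertible pseudonatural    *)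
(* transformation from the identity to [star] applied twice, with identity    *)
(* 1-morphisms as components at objects; the last four make [star F] right    *)
(* adjoint to [F].                                                            *)
Record fiab (K : fieldType) := Fiab {
  fiab_bicat :> finbicat K;
  star : forall i j : fiab_bicat, bhom i j -> bhom j i;
  star2 : forall (i j : fiab_bicat) (F G : bhom i j),
    mor F G -> mor (star G) (star F);
  star2_lin : forall (i j : fiab_bicat) (F G : bhom i j),
    linear (fun a : mor F G => star2 a);
  star2_id : forall (i j : fiab_bicat) (F : bhom i j),
    star2 (idm F) = idm (star F);
  star2_v : forall (i j : fiab_bicat) (F G H : bhom i j)
    (b : mor G H) (a : mor F G), star2 (b \v a) = star2 a \v star2 b;
  scmp : forall (i j k : fiab_bicat) (F : bhom j k) (G : bhom i j),
    iso (star (F \c G)) (star G \c star F);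
  sone : forall i : fiab_bicat, iso (star (one i)) (one i);
  scmp_nat : forall (i j k : fiab_bicat)
    (F F' : bhom j k) (G G' : bhom i j)
    (a : mor F F') (b : mor G G'),
    scmp F G \v star2 (a \h b) = (star2 b \h star2 a) \v scmp F' G';
  sassoc : forall (i j k l : fiab_bicat)
    (F : bhom k l) (G : bhom j k) (H : bhom i j),
    (idm (star H) \h scmp F G) \v scmp (F \c G) H \v star2 (assoc F G H)
    = assoc (star H) (star G) (star F) \v (scmp G H \h idm (star F))
        \v scmp F (G \c H);
  sunit_l : forall (i j : fiab_bicat) (F : bhom i j),
    runit (star F) \v (idm (star F) \h sone j) \v scmp (one j) F
      \v star2 (lunit F) = idm (star F);
  sunit_r : forall (i j : fiab_bicat) (F : bhom i j),
    lunit (star F) \v (sone i \h idm (star F)) \v scmp F (one i)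
      \v star2 (runit F) = idm (star F);
  sinv : forall (i j : fiab_bicat) (F : bhom i j), iso F (star (star F));
  sinv_nat : forall (i j : fiab_bicat) (F G : bhom i j) (a : mor F G),
    star2 (star2 a) \v sinv F = sinv G \v a;
  sinv_cmp : forall (i j k : fiab_bicat)
    (F : bhom j k) (G : bhom i j),
    star2 (scmp F G) \v ibwd (scmp (star G) (star F)) \v (sinv F \h sinv G)
    = sinv (F \c G);
  sinv_one : forall i : fiab_bicat,
    star2 (sone i) = sinv (one i) \v sone i;
  ev : forall (i j : fiab_bicat) (F : bhom i j),
    mor (F \c star F) (one j);
  coev : forall (i j : fiab_bicat) (F : bhom i j),
    mor (one i) (star F \c F);
  zigzag1 : forall (i j : fiab_bicat) (F : bhom i j),
    lunit F \v (ev F \h idm F) \v ibwd (assoc F (star F) F)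
      \v (idm F \h coev F) \v ibwd (runit F) = idm F;
  zigzag2 : forall (i j : fiab_bicat) (F : bhom i j),
    runit (star F) \v (idm (star F) \h ev F) \v assoc (star F) F (star F)
      \v (coev F \h idm (star F)) \v ibwd (lunit (star F)) = idm (star F)
}.

(* The constructor forces [F] and [G] to have the same codomain, as is        *)
(* necessary for [G] to be a summand of some [F \c H].                        *)
Inductive leR (K : fieldType) (C : finbicat K) (i j : C) (F : bhom i j)
    (k : C) : forall l : C, bhom k l -> Prop :=
  LeR (H : bhom k i) (G : bhom k j) : summand G (F \c H) -> leR F G.

Section Abelianization.
Variables (K : fieldType) (A : lincat K).

(* An object is a morphism of [A], to be thought of as a presentation of its  *)
(* cokernel.  The morphisms from [x] to [y] are the commutative squares       *)
(* modulo [peq], i.e. modulo those whose second component factors through     *)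
(* [pmap y].                                                                  *)
Record pres := Pres { psrc : A; ptgt : A; pmap : mor psrc ptgt }.

Record pmor (x y : pres) := PMor {
  pm0 : mor (psrc x) (psrc y);
  pm1 : mor (ptgt x) (ptgt y);
  pmP : pm1 \v pmap x = pmap y \v pm0
}.

Definition peq (x y : pres) (f g : pmor x y) : Prop :=
  exists s : mor (ptgt x) (psrc y), pm1 f - pm1 g = pmap y \v s.

Fact pid_subproof (x : pres) : idm (ptgt x) \v pmap x = pmap x \v idm (psrc x).
Proof. by rewrite cmp1m cmpm1. Qed.

Definition pid (x : pres) : pmor x x := PMor (pid_subproof x).

Fact pcmp_subproof (x y z : pres) (g : pmor y z) (f : pmor x y) :
  (pm1 g \v pm1 f) \v pmap x = pmap z \v (pm0 g \v pm0 f).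
Proof. by rewrite -cmpA pmP cmpA pmP cmpA. Qed.

Definition pcmp (x y z : pres) (g : pmor y z) (f : pmor x y) : pmor x z :=
  PMor (pcmp_subproof g f).

Fact pzero_subproof (x y : pres) :
  (0 : mor (ptgt x) (ptgt y)) \v pmap x = pmap y \v (0 : mor (psrc x) (psrc y)).
Proof. by rewrite cmp0m cmpm0. Qed.

Definition pzero (x y : pres) : pmor x y := PMor (pzero_subproof x y).

Definition pis_zero (x : pres) : Prop := peq (pid x) (pzero x x).

Definition pis_mono (x y : pres) (m : pmor x y) : Prop :=
  forall (z : pres) (u v : pmor z x), peq (pcmp m u) (pcmp m v) -> peq u v.

Definition pis_epi (x y : pres) (e : pmor x y) : Prop :=
  forall (z : pres) (u v : pmor y z), peq (pcmp u e) (pcmp v e) -> peq u v.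

Definition pis_iso (x y : pres) (f : pmor x y) : Prop :=
  exists g : pmor y x, peq (pcmp g f) (pid x) /\ peq (pcmp f g) (pid y).

Definition psimple (x : pres) : Prop :=
  ~ pis_zero x /\
  forall (y : pres) (m : pmor y x), pis_mono m -> pis_zero y \/ pis_iso m.

(* [l] is simple and is the largest semisimple quotient of [p]: every         *)
(* morphism from [p] to a simple object factors through [p -> l].             *)
Definition simple_top (p l : pres) : Prop :=
  psimple l /\
  exists2 e : pmor p l, pis_epi e &
    forall (s : pres) (f : pmor p s), psimple s ->
      exists g : pmor l s, peq f (pcmp g e).

End Abelianization.

(* The projective object [0 -> X] of the abelianization attached to [X]. *)
Definition pproj (K : fieldType) (A : fincat K) (X : A) : pres A :=
  @Pres K A zob X 0.

Section Principal.
Variables (K : fieldType) (C : finbicat K).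

(* The value at [j] of the abelianized principal birepresentation of [i]. *)
Definition Pbar (i j : C) : Type := pres (bhom i j).

Definition Pbar_act (i j k : C) (A : bhom j k) (x : Pbar i j) : Pbar i k :=
  Pres (idm A \h pmap x).

Fact Pbar_eval_subproof (i j k : C) (A B : bhom j k) (a : mor A B)
    (x : Pbar i j) :
  (a \h idm (ptgt x)) \v pmap (Pbar_act A x)
  = pmap (Pbar_act B x) \v (a \h idm (psrc x)).
Proof. by rewrite /= -!hcmp_v !cmp1m !cmpm1. Qed.

Definition Pbar_eval (i j k : C) (A B : bhom j k) (a : mor A B) (x : Pbar i j) :
    pmor (Pbar_act A x) (Pbar_act B x) :=
  @PMor _ _ (Pbar_act A x) (Pbar_act B x)
    (a \h idm (psrc x)) (a \h idm (ptgt x)) (Pbar_eval_subproof a x).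

Definition is_L (i j : C) (F : bhom i j) (L : Pbar i j) : Prop :=
  simple_top (pproj F) L.

(* Membership of the 2-morphism [a] in the annihilator of [L].  When the      *)
(* domain [k] of the 1-morphisms [A] and [B] differs from [j] the condition   *)
(* holds vacuously; otherwise [L] is transported along [j = k].               *)
Definition ann (i j : C) (L : Pbar i j) (k l : C) (A B : bhom k l)
    (a : mor A B) : Prop :=
  forall e : j = k,
    let L' := eq_rect j (Pbar i) L k e in
    peq (Pbar_eval a L') (pzero (Pbar_act A L') (Pbar_act B L')).

End Principal.

(* Main.v *)
Require Import Defs.
From HB Require Import structures.
From mathcomp Require Import all_boot all_order all_algebra.
From mathcomp Require Import complex reals.
From mathcomp Require Import boolp.

(** Throughout, an object of the abelianization is a presentation
    [x : X -> Y] and is handled through the morphisms [u : W -> Y] into it from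
    projective objects.  Such a [u] represents zero exactly when it factors
    through [x], written [vanishes x u].

    Two facts about a simple top [l] of an indecomposable 1-morphism [F], with
    projection [e : F -> l], carry the argument.  A nonzero morphism to [l]
    from the projective object of a 1-morphism [Z] is onto, so [e] lifts along
    it, and [F] is a direct summand of [Z] ([top_summand]).  And [F] has a
    largest proper subobject: whatever a nonzero morphism out of [F] kills is
    also killed by [e] ([top_cover_max]).  Both rest on the endomorphism ring
    of [F] being local ([indec_End_local]); the first also needs images, hence
    weak kernels, which exist because the category has finitely many
    indecomposable objects and finite dimensional morphism spaces
    ([weak_kernel_ex]).

    For (b) => (a), adjunction turns morphisms [Z -> F^* L_G] into morphisms
    [F Z -> L_G].  Thus [F^*] acts on [L_F] by a nonzero object, and if it also
    does on [L_G], then [G] is a summand of some [F Z].  The inclusion of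
    annihilators, applied to the identity of [F^*], provides this.

    For (a) => (b), let [G] be a summand of [F H] and let [a : A -> B]
    annihilate [L_G].  The nonzero morphism [F H -> L_G] transposes to a nonzero
    morphism [f : F -> M], with [M := L_G h] for a left adjoint [h] of [H].  As
    the right action of [h] commutes with the left action of 2-morphisms, [a]
    annihilates [M], so [B f] kills the component [A F -> B F] of [a].  Moving
    [B] to the other side by adjunction gives a morphism into [F] killed by
    [f], hence by [e]; so [B e] kills the component of [a] too, and [a]
    annihilates the quotient [L_F] of [F]. *)

Set Implicit Arguments.
Unset Strict Implicit.
Unset Printing Implicit Defensive.

(* The field [pmap] of presentations has to take precedence over the function *)
(* of that name on sequences.                                                 *)
Import Defs GRing.Theory.
Local Open Scope ring_scope.
Local Open Scope bicat_scope.

(** * Linear categories *)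

Section LinearCategory.
Variables (K : fieldType) (A : lincat K).
Implicit Types X Y Z W : A.

Definition postcmp X Y Z (g : mor Y Z) (f : mor X Y) := g \v f.
Definition precmp X Y Z (f : mor X Y) (g : mor Y Z) := g \v f.

HB.instance Definition _ X Y Z (g : mor Y Z) :=
  GRing.isLinear.Build K (mor X Y) (mor X Z) _ (@postcmp X Y Z g) (cmp_linr g).
HB.instance Definition _ X Y Z (f : mor X Y) :=
  GRing.isLinear.Build K (mor Y Z) (mor X Z) _ (@precmp X Y Z f) (cmp_linl f).

Lemma cmpDr X Y Z (g : mor Y Z) (f f' : mor X Y) :
  g \v (f + f') = g \v f + g \v f'.
Proof. exact: (raddfD (postcmp g)). Qed.

Lemma cmpBr X Y Z (g : mor Y Z) (f f' : mor X Y) :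
  g \v (f - f') = g \v f - g \v f'.
Proof. exact: (raddfB (postcmp g)). Qed.

Lemma cmpZr X Y Z (g : mor Y Z) a (f : mor X Y) :
  g \v (a *: f) = a *: (g \v f).
Proof. exact: (linearZZ (postcmp g)). Qed.

Lemma cmpDl X Y Z (g g' : mor Y Z) (f : mor X Y) :
  (g + g') \v f = g \v f + g' \v f.
Proof. exact: (raddfD (precmp f)). Qed.

Lemma cmpBl X Y Z (g g' : mor Y Z) (f : mor X Y) :
  (g - g') \v f = g \v f - g' \v f.
Proof. exact: (raddfB (precmp f)). Qed.

(** With composites nested to the right, this rewrites by an equation between
    two-fold composites in the middle of a longer composite. *)
Lemma cmp_rewrite X Y Z W (g : mor Y Z) (f : mor X Y) (h : mor X Z)
    (k : mor W X) : g \v f = h -> g \v (f \v k) = h \v k.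
Proof. by rewrite cmpA => ->. Qed.

(** For a presentation [x] of an object [l], the morphisms to [l] from the
    projective object on [W] are the [u : W -> Y] modulo those for which
    [vanishes x u]. *)
Definition vanishes X Y W (x : mor X Y) (u : mor W Y) : Prop :=
  exists s : mor W X, u = x \v s.

Lemma vanishes0 X Y W (x : mor X Y) : vanishes x (0 : mor W Y).
Proof. by exists 0; rewrite cmpm0. Qed.

Lemma vanishesD X Y W (x : mor X Y) (u v : mor W Y) :
  vanishes x u -> vanishes x v -> vanishes x (u + v).
Proof. by move=> [s ->] [t ->]; exists (s + t); rewrite cmpDr. Qed.

Lemma vanishesZ X Y W (x : mor X Y) a (u : mor W Y) :
  vanishes x u -> vanishes x (a *: u).
Proof. by move=> [s ->]; exists (a *: s); rewrite cmpZr. Qed.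

Lemma vanishes_cmp X Y W W' (x : mor X Y) (u : mor W Y) (h : mor W' W) :
  vanishes x u -> vanishes x (u \v h).
Proof. by move=> [s ->]; exists (s \v h); rewrite cmpA. Qed.

Lemma vanishes_self X Y W (x : mor X Y) (s : mor W X) : vanishes x (x \v s).
Proof. by exists s. Qed.

Lemma vanishes_trans X Y Z W (x : mor X Y) (y : mor Z Y) (u : mor W Y) :
  vanishes x y -> vanishes y u -> vanishes x u.
Proof. by move=> [s ->] [t ->]; exists (s \v t); rewrite cmpA. Qed.

(** [End X] embeds in the corner of [End S] cut out by the idempotent of [X],
    and the identity of [S] lies outside that corner. *)
Lemma dim_End_dsum S X Y : is_dsum S X Y -> ~ is_zero Y ->
  (\dim {:mor X X} < \dim {:mor S S})%N.
Proof.
move=> [i1 [i2 [p1 [p2 [p1i1 p2i2 p1i2 p2i1 _]]]]] nzY.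
pose f := linfun (postcmp i1 \o precmp p1 : mor X X -> mor S S).
have fE a : f a = i1 \v (a \v p1) by rewrite lfunE.
have f_inj : lker f == 0%VS.
  apply/lker0P => a b; rewrite !fE => /(congr1 (fun g => p1 \v g \v i1)).
  by rewrite !cmpA p1i1 !cmp1m -!cmpA p1i1 !cmpm1.
rewrite -(limg_dim_eq (f := f) (U := fullv)); last by rewrite (eqP f_inj) capv0.
rewrite (ltn_leqif (dimv_leqif_eq (subvf _))); apply/negP => /eqP full.
have /memv_imgP[a _ idE] : idm S \in limg f by rewrite full memvf.
apply: nzY; move/(congr1 (fun g => p2 \v g \v i2)): idE.
by rewrite fE cmpm1 p2i2 !cmpA p2i1 !cmp0m.
Qed.

Lemma dsum_sym S X Y : is_dsum S X Y -> is_dsum S Y X.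
Proof.
move=> [i1 [i2 [p1 [p2 [? ? ? ? e]]]]].
by exists i2, i1, p2, p1; split=> //; rewrite addrC.
Qed.

(** The existence part of the Krull-Schmidt theorem, as an induction principle;
    splitting terminates because the dimension of the endomorphism algebra
    drops. *)
Lemma dsum_ind (P : A -> Prop) :
    (forall X, is_zero X -> P X) ->
    (forall X, indecomposable X -> P X) ->
    (forall S X Y, is_dsum S X Y -> P X -> P Y -> P S) ->
  forall X, P X.
Proof.
move=> P0 Pi Ps X.
move: {2}_.+1 (ltnSn (\dim {:mor X X})) => n; elim: n X => // n IHn S le_n.
have [zS|nzS] := EM (is_zero S); first exact: P0.
have [|S_dec] := EM (indecomposable S); first exact: Pi.
have [X [Y [dS nzX nzY]]] :
    exists X Y, [/\ is_dsum S X Y, ~ is_zero X & ~ is_zero Y].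
  apply: contrapT => noXY; apply: S_dec; split=> // X Y dS.
  have [|nzX] := EM (is_zero X); first by left.
  have [|nzY] := EM (is_zero Y); first by right.
  by case: noXY; exists X, Y.
apply: (Ps _ _ _ dS); apply: IHn.
  exact: leq_trans (dim_End_dsum dS nzY) le_n.
exact: leq_trans (dim_End_dsum (dsum_sym dS) nzX) le_n.
Qed.

End LinearCategory.

(** * Weak kernels *)

Section WeakKernel.
Variables (K : fieldType) (A : fincat K) (X Y Z : A).
Variables (x : mor X Y) (v : mor Z Y).

Let null (W : A) (w : mor W Z) : Prop := vanishes x (v \v w).

Let cover2 (W1 W2 : A) (w1 : mor W1 Z) (w2 : mor W2 Z) :
  null w1 -> null w2 ->
  exists (R : A) (r : mor R Z), [/\ null r, vanishes r w1 & vanishes r w2].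
Proof.
move=> n1 n2; have [R [i1 [i2 [p1 [p2 [e1 e2 e12 e21 _]]]]]] := dsum_ex W1 W2.
exists R, (w1 \v p1 + w2 \v p2); split.
- by rewrite /null cmpDr !cmpA; apply: vanishesD; apply: vanishes_cmp.
- by exists i1; rewrite cmpDl -!cmpA e1 e21 cmpm1 cmpm0 addr0.
- by exists i2; rewrite cmpDl -!cmpA e2 e12 cmpm1 cmpm0 add0r.
Qed.

(** A basis of the space of null morphisms from [T] is finite, and finitely many
    null morphisms factor through the null morphism they induce on the direct
    sum of their sources. *)
Let cover_hom (T : A) :
  exists (R : A) (r : mor R Z),
    null r /\ forall w : mor T Z, null w -> vanishes r w.
Proof.
pose N := (linfun (postcmp v : mor T Z -> mor T Y)
  @^-1: limg (linfun (postcmp x : mor T X -> mor T Y)))%VS.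
have NP w : null w <-> w \in N.
  rewrite /N -memv_preim lfunE /=; split=> [[s E]|/memv_imgP[s _]].
    by apply/memv_imgP; exists s; rewrite ?memvf // lfunE.
  by rewrite lfunE => E; exists s.
have [R [r [nr cov]]] : exists (R : A) (r : mor R Z),
    null r /\ forall w, w \in (vbasis N : seq _) -> vanishes r w.
  have : {subset (vbasis N : seq _) <= N} by move=> w; apply: vbasis_mem.
  elim: (vbasis N : seq _) => [_|w s IHs sN].
    by exists zob, 0; split=> //; rewrite /null cmpm0; apply: vanishes0.
  have [w' ws|R [r [nr cov]]] := IHs; first by apply: sN; rewrite inE ws orbT.
  have [||R' [r' [nr' r'r r'w]]] := @cover2 _ _ r w; first by [].
    by apply/NP/sN; rewrite mem_head.
  exists R', r'; split=> // w'; rewrite inE => /predU1P[->//|/cov].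
  exact: vanishes_trans.
exists R, r; split=> // w /NP /coord_vbasis ->.
elim/big_ind: _ => [||i _]; first exact: vanishes0.
- by move=> *; apply: vanishesD.
- by apply/vanishesZ/cov/mem_nth; rewrite size_tuple.
Qed.

(** Factoring null morphisms from the finitely many indecomposable objects
    suffices, since every object is a direct sum of these. *)
Lemma weak_kernel_ex : exists (R : A) (r : mor R Z),
  null r /\ forall (W : A) (w : mor W Z), null w -> vanishes r w.
Proof.
have [n [T T_all]] := @fincat_fin _ A.
have cover_upto m : exists (R : A) (r : mor R Z), null r /\
    forall k : 'I_n, (k < m)%N ->
      forall w : mor (T k) Z, null w -> vanishes r w.
  elim: m => [|m [R [r [nr cov]]]].
    by exists zob, 0; split=> //; rewrite /null cmpm0; apply: vanishes0.
  have [lt_mn|le_nm] := ltnP m n; last first.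
    exists R, r; split=> // k lt_km; apply: cov.
    exact: leq_trans (ltn_ord k) le_nm.
  have [R' [r' [nr' cov']]] := cover_hom (T (Ordinal lt_mn)).
  have [R2 [r2 [nr2 r2r r2r']]] := cover2 nr nr'.
  exists R2, r2; split=> // k.
  rewrite ltnS leq_eqVlt => /orP[/eqP km|lt_km] w nw.
    have {}km : k = Ordinal lt_mn by apply: val_inj.
    by apply: vanishes_trans r2r' _; subst k; apply: cov'.
  by apply: vanishes_trans r2r _; apply: cov lt_km _ _.
have [R [r [nr cov]]] := cover_upto n; exists R, r; split=> //; apply: dsum_ind.
- move=> W zW w _; rewrite -(cmpm1 w) zW cmpm0; exact: vanishes0.
- move=> W iW w nw; have [k [f]] := T_all _ iW.
  rewrite -(cmpm1 w) -(iso_bf f) cmpA; apply/vanishes_cmp/cov => //.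
  by rewrite /null cmpA; apply: vanishes_cmp.
- move=> S W1 W2 [i1 [i2 [p1 [p2 [_ _ _ _ idE]]]]] IH1 IH2 w nw.
  rewrite -(cmpm1 w) -idE cmpDr !cmpA; apply: vanishesD; apply: vanishes_cmp.
    by apply: IH1; rewrite /null cmpA; apply: vanishes_cmp.
  by apply: IH2; rewrite /null cmpA; apply: vanishes_cmp.
Qed.

End WeakKernel.

(** * Local endomorphism rings *)

Section Fitting.
Variables (K : fieldType) (A : fincat K).
Implicit Types X Y Z : A.

Lemma retract_dsum X Y (q : mor X Y) (p : mor Y X) : p \v q = idm X ->
  exists Z (r : mor Y Z) (s : mor Z Y),
    s \v r = idm Y - q \v p /\ is_dsum Y X Z.
Proof.
move=> pq; have [|Z [r [s [rs sr]]]] := @fincat_split _ A _ (idm Y - q \v p).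
  rewrite cmpBl cmp1m cmpBr cmpm1 -cmpA (cmp_rewrite _ pq) cmp1m.
  by rewrite subrr subr0.
have ps : p \v s = 0.
  rewrite -(cmpm1 s) -rs (cmpA s) sr cmpA cmpBr cmpm1 cmpA pq cmp1m subrr.
  exact: cmp0m.
have rq : r \v q = 0.
  rewrite -(cmp1m r) -rs -(cmpA r) sr -cmpA cmpBl cmp1m -cmpA pq cmpm1 subrr.
  exact: cmpm0.
exists Z, r, s; split=> //; exists q, s, p, r.
by split=> //; rewrite sr addrC subrK.
Qed.

Lemma indec_idem X (f : mor X X) :
  indecomposable X -> f \v f = f -> f = 0 \/ f = idm X.
Proof.
move=> [_ iX] ff; have [Z [r [s [rs sr]]]] := @fincat_split _ A _ _ ff.
have [W [r' [s' [s'r' dX]]]] := retract_dsum rs.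
have [zZ|zW] := iX _ _ dX; first by left; rewrite -sr -(cmp1m r) zZ cmp0m cmpm0.
right; apply/esym/eqP; rewrite -subr_eq0 -sr -s'r' -(cmp1m r') zW.
by rewrite cmp0m cmpm0.
Qed.

Fixpoint cpow X (c : mor X X) n : mor X X :=
  if n is m.+1 then c \v cpow c m else idm X.

Lemma cpowD X (c : mor X X) m n : cpow c (m + n) = cpow c m \v cpow c n.
Proof. by elim: m => [|m IH]; rewrite ?cmp1m //= IH cmpA. Qed.

(** The right ideals [c^n End X] decrease with [n], as do the left ideals
    [(End X) c^n], so for large [n] neither changes from [n] to [2n].  Both
    chains are dealt with at once by minimizing the sum of the dimensions.
    The exponent is positive, so that [c] is invertible if its power is. *)
Lemma cpow_stable X (c : mor X X) : exists n d d',
  cpow c n.+1 = cpow c n.+1 \v cpow c n.+1 \v d /\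
  cpow c n.+1 = d' \v (cpow c n.+1 \v cpow c n.+1).
Proof.
pose U n := limg (linfun (postcmp (cpow c n.+1) : mor X X -> mor X X)).
pose V n := limg (linfun (precmp (cpow c n.+1) : mor X X -> mor X X)).
have leU n : (U (n + n.+1)%N <= U n)%VS.
  apply/subvP => _ /memv_imgP[f _ ->]; apply/memv_imgP.
  exists (cpow c n.+1 \v f); rewrite ?memvf // !lfunE /= /postcmp.
  by rewrite -[c \v _]/(cpow c (n.+1 + n.+1)) cpowD -cmpA.
have leV n : (V (n + n.+1)%N <= V n)%VS.
  apply/subvP => _ /memv_imgP[f _ ->]; apply/memv_imgP.
  exists (f \v cpow c n.+1); rewrite ?memvf // !lfunE /= /precmp.
  by rewrite -[c \v _]/(cpow c (n.+1 + n.+1)) cpowD cmpA.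
pose P m := `[<exists n, m = (\dim (U n) + \dim (V n))%N>].
have exP : exists m, P m.
  by exists (\dim (U 0%N) + \dim (V 0%N))%N; apply/asboolP; exists 0%N.
case: (ex_minnP exP) => m /asboolP[n ->] min_n.
have {}min_n := min_n _ (asboolT (ex_intro _ (n + n.+1)%N erefl)).
have dU := dimvS (leU n); have dV := dimvS (leV n).
have eqU : U (n + n.+1)%N == U n.
  rewrite -(geq_leqif (dimv_leqif_eq (leU n))) -(leq_add2r (\dim (V n))).
  by apply: leq_trans min_n _; rewrite leq_add2l.
have eqV : V (n + n.+1)%N == V n.
  rewrite -(geq_leqif (dimv_leqif_eq (leV n))) -(leq_add2l (\dim (U n))).
  by apply: leq_trans min_n _; rewrite leq_add2r.
have /memv_imgP[d _ dE] : cpow c n.+1 \in U (n + n.+1)%N.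
  rewrite (eqP eqU); apply/memv_imgP; exists (idm X); rewrite ?memvf //.
  by rewrite lfunE /= /postcmp cmpm1.
have /memv_imgP[d' _ d'E] : cpow c n.+1 \in V (n + n.+1)%N.
  rewrite (eqP eqV); apply/memv_imgP; exists (idm X); rewrite ?memvf //.
  by rewrite lfunE /= /precmp cmp1m.
exists n, d, d'; rewrite -cpowD; split.
  by rewrite {1}dE lfunE.
by rewrite {1}d'E lfunE.
Qed.

(** Fitting's lemma.  If [b = c^n] satisfies [b = b b d = d' b b], then
    [b d = d' b] is an idempotent, hence [0] or [1]: in the first case
    [b = b (b d) = 0], in the second [b] is invertible. *)
Lemma indec_End_local X (c : mor X X) : indecomposable X ->
  (exists n, cpow c n = 0) \/ exists c', c \v c' = idm X /\ c' \v c = idm X.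
Proof.
move=> iX; have [n [d [d' [bd d'b]]]] := cpow_stable c.
move Eb: (cpow c n.+1) bd d'b => b bd d'b.
have d'b_bd : d' \v b = b \v d by rewrite {1}bd !cmpA -(cmpA d') -d'b.
have [|b0|b1] := @indec_idem X (b \v d) iX.
- by rewrite -{1}d'b_bd -!cmpA (cmpA b b) -bd d'b_bd.
- by left; exists n.+1; rewrite Eb bd -cmpA b0 cmpm0.
have cb : cpow c n \v c = b.
  by rewrite -{2}(cmpm1 c) -[c \v idm X]/(cpow c 1) -cpowD addn1.
have cr : c \v (cpow c n \v d) = idm X by rewrite cmpA -b1 -Eb.
have cl : d' \v cpow c n \v c = idm X by rewrite -cmpA cb d'b_bd.
right; exists (cpow c n \v d); split=> //.
by rewrite -[cpow c n \v d]cmp1m -cl -(cmpA _ c) cr cmpm1 cl.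
Qed.

End Fitting.

(** * Simple tops *)

Section SimpleTop.
Variables (K : fieldType) (A : fincat K).
Implicit Types X Y Z : A.

Lemma peqE (x y : pres A) (f g : pmor x y) :
  peq f g <-> vanishes (pmap y) (pm1 f - pm1 g).
Proof. by []. Qed.

(** The image of [v] is a nonzero subobject of a simple object; it is presented
    by a weak kernel of [v]. *)
Lemma simple_onto (l : pres A) Z (v : mor Z (ptgt l)) :
    psimple l -> ~ vanishes (pmap l) v ->
  exists s : mor (ptgt l) Z, vanishes (pmap l) (v \v s - idm _).
Proof.
move=> [nzl mono_l] nv.
have [R [r [[r0 vr] rker]]] := weak_kernel_ex (pmap l) v.
pose m := @PMor _ _ (Pres r) l _ _ vr.
have [z u u'|z0|[g [_ mg]]] := mono_l (Pres r) m.
- by rewrite !peqE /= -cmpBr => /rker.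
- case: nv; move/peqE: z0; rewrite /= subr0 => -[s idE].
  by rewrite -(cmpm1 v) idE cmpA vr -cmpA; exists (r0 \v s).
by exists (pm1 g); move/peqE: mg.
Qed.

(** What is used of the projection [e] of an indecomposable projective object
    onto its simple top: it is nonzero, it is onto, and it lifts along every
    nonzero morphism from a projective object to the simple object, such a
    morphism being onto. *)
Definition top_cover X Y Y' (x : mor Y' Y) (e : mor X Y) : Prop :=
  [/\ ~ vanishes x e,
      exists s, vanishes x (e \v s - idm Y)
    & forall Z (v : mor Z Y), ~ vanishes x v ->
        exists q : mor X Z, vanishes x (v \v q - e)].

Lemma top_cover_ex X (l : pres A) : simple_top (pproj X) l ->
  exists e : mor X (ptgt l), top_cover (pmap l) e.
Proof.
move=> [l_simple [e epi_e _]]; exists (pm1 e).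
have ne : ~ vanishes (pmap l) (pm1 e).
  move=> e0; case: l_simple => nzl _; apply: nzl; apply: epi_e.
  by apply/peqE; rewrite /= cmp1m cmp0m subr0.
split=> // [|Z v nv]; first exact: simple_onto.
have [s vs] := simple_onto l_simple nv; exists (s \v pm1 e).
by have := vanishes_cmp (pm1 e) vs; rewrite cmpBl cmp1m -cmpA.
Qed.

(** A nilpotent [c] is excluded, as [e = e c^n] modulo [x] for all [n]. *)
Lemma cover_rigid X Y Y' (x : mor Y' Y) (e : mor X Y) (c : mor X X) :
    indecomposable X -> ~ vanishes x e -> vanishes x (e \v c - e) ->
  exists c', c \v c' = idm X /\ c' \v c = idm X.
Proof.
move=> iX ne ec; have [[n c0]|//] := indec_End_local c iX.
case: ne; have: vanishes x (e \v cpow c n - e).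
  elim: n {c0} => [|n IH] /=; first by rewrite cmpm1 subrr; apply: vanishes0.
  rewrite -(subrKA (e \v cpow c n)) cmpA -cmpBl.
  by apply: vanishesD => //; apply: vanishes_cmp.
rewrite c0 cmpm0 sub0r => e0; rewrite -(opprK e) -scaleN1r.
exact: vanishesZ.
Qed.

Lemma top_summand X (l : pres A) Z (v : mor Z (ptgt l)) :
    indecomposable X -> simple_top (pproj X) l -> ~ vanishes (pmap l) v ->
  summand X Z.
Proof.
move=> iX /top_cover_ex[e [ne [s es] lift]] nv; have [q vq] := lift _ _ nv.
(* Both [q] and [s \v v] are compatible with the projections to [l], so the   *)
(* composite endomorphism of [X] is too.                                      *)
have [|c' [_ c'c]] := @cover_rigid _ _ _ (pmap l) e (s \v v \v q) iX ne.
  rewrite -(subrKA (v \v q)) -cmpA cmpA -{2}(cmp1m (v \v q)) -cmpBl.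
  by apply: vanishesD => //; apply: vanishes_cmp.
have [|W [_ [_ [_ dZ]]]] := @retract_dsum _ _ _ _ q (c' \v s \v v).
  by rewrite -!cmpA (cmpA s).
by exists W.
Qed.

(** The kernel of [e] is the largest proper subobject of [X]: if [e \v w] were
    nonzero, [e] would lift along it, making [w] a split epimorphism. *)
Lemma top_cover_max X Y Y' (x : mor Y' Y) (e : mor X Y) Z Z' W
    (y : mor Z' Z) (f : mor X Z) (w : mor W X) :
    indecomposable X -> top_cover x e -> ~ vanishes y f ->
  vanishes y (f \v w) -> vanishes x (e \v w).
Proof.
move=> iX [ne _ lift] nf fw; apply: contrapT => /lift[q]; rewrite -cmpA => ec.
have [c' [cc' _]] := cover_rigid iX ne ec.
by apply: nf; rewrite -(cmpm1 f) -cc' !cmpA; do 2!apply: vanishes_cmp.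
Qed.

End SimpleTop.

(** * Transposition along the adjunctions *)

Section Whiskering.
Variables (K : fieldType) (C : finbicat K).

Lemma whisker_l_cmp (i j k : C) (F : bhom j k) (G G' G'' : bhom i j)
    (b' : mor G' G'') (b : mor G G') :
  idm F \h (b' \v b) = (idm F \h b') \v (idm F \h b).
Proof. by rewrite -hcmp_v cmp1m. Qed.

Lemma whisker_r_cmp (i j k : C) (F F' F'' : bhom j k) (G : bhom i j)
    (a' : mor F' F'') (a : mor F F') :
  (a' \v a) \h idm G = (a' \h idm G) \v (a \h idm G).
Proof. by rewrite -hcmp_v cmp1m. Qed.

Lemma interchange (i j k : C) (F F' : bhom j k) (G G' : bhom i j)
    (a : mor F F') (b : mor G G') :
  (a \h idm G') \v (idm F \h b) = (idm F' \h b) \v (a \h idm G).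
Proof. by rewrite -!hcmp_v !cmp1m !cmpm1. Qed.

Lemma whisker_l_iso (i j k : C) (F : bhom j k) (G G' : bhom i j)
    (b : mor G G') (b' : mor G' G) :
  b' \v b = idm G -> (idm F \h b') \v (idm F \h b) = idm (F \c G).
Proof. by move=> b'b; rewrite -whisker_l_cmp b'b hcmp1. Qed.

Lemma whisker_r_iso (i j k : C) (F F' : bhom j k) (G : bhom i j)
    (a : mor F F') (a' : mor F' F) :
  a' \v a = idm F -> (a' \h idm G) \v (a \h idm G) = idm (F \c G).
Proof. by move=> a'a; rewrite -whisker_r_cmp a'a hcmp1. Qed.

Lemma assoc_inv_nat (i j k l : C) (F F' : bhom k l) (G G' : bhom j k)
    (H H' : bhom i j) (a : mor F F') (b : mor G G') (c : mor H H') :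
  ibwd (assoc F' G' H') \v (a \h (b \h c))
  = ((a \h b) \h c) \v ibwd (assoc F G H).
Proof.
rewrite -[LHS]cmpm1 -(iso_fb (assoc F G H)) -!cmpA.
rewrite (cmp_rewrite _ (esym (assoc_nat a b c))).
by rewrite -!cmpA (cmp_rewrite _ (iso_bf _)) cmp1m.
Qed.

End Whiskering.

Section Transpose.
Variables (K : fieldType) (C : fiab K).

Section Left.
Variables (i j k : C) (D : bhom k j) (U : bhom i k).

Definition transp (Y : bhom i j) (u : mor U (star D \c Y)) : mor (D \c U) Y :=
  lunit Y \v (ev D \h idm Y) \v ibwd (assoc D (star D) Y) \v (idm D \h u).

Lemma transp_nat (Y Y' : bhom i j) (g : mor Y Y') (u : mor U (star D \c Y)) :
  transp ((idm (star D) \h g) \v u) = g \v transp u.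
Proof.
rewrite /transp whisker_l_cmp -!cmpA (cmp_rewrite _ (assoc_inv_nat _ _ _)).
rewrite hcmp1 -!cmpA (cmp_rewrite _ (interchange _ _)) -!cmpA.
by rewrite (cmp_rewrite _ (lunit_nat _)) -!cmpA.
Qed.

(** Transposing back recovers [u] up to natural isomorphisms.  The composite
    [lunit (star D) \h idm] after the inverse associator equals [lunit] of
    [star D \c Y]; keeping it in this form makes the triangle and pentagon
    axioms enough for the proof, and the form is natural in [Y], which is all
    that matters for vanishing. *)
Lemma transpK (Y : bhom i j) (u : mor U (star D \c Y)) :
  (idm (star D) \h transp u) \v assoc (star D) D U \v (coev D \h idm U)
  = (lunit (star D) \h idm Y) \v ibwd (assoc (one k) (star D) Y)
      \v (idm (one k) \h u).
Proof.
set B := star D.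
have pent : (idm B \h ibwd (assoc D B Y)) \v assoc B D (B \c Y)
    = assoc B (D \c B) Y \v (assoc B D B \h idm Y) \v ibwd (assoc (B \c D) B Y).
  rewrite -[LHS]cmpm1 -(iso_fb (assoc (B \c D) B Y)) -!cmpA.
  rewrite (cmp_rewrite _ (pentagon _ _ _ _)) -!cmpA.
  by rewrite (cmp_rewrite _ (whisker_l_iso _ (iso_bf _))) cmp1m.
have zig : (runit B \v (idm B \h ev D) \v assoc B D B \v (coev D \h idm B))
    = lunit B.
  by rewrite -[LHS]cmpm1 -(iso_bf (lunit B)) cmpA zigzag2 cmp1m.
rewrite /transp !whisker_l_cmp -!cmpA.
rewrite (cmp_rewrite _ (esym (assoc_nat _ _ _))) hcmp1 -!cmpA -interchange.
rewrite (cmp_rewrite _ pent) -!cmpA -[idm (B \c Y)]hcmp1.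
rewrite (cmp_rewrite _ (assoc_inv_nat _ _ _)) -!cmpA.
rewrite (cmp_rewrite _ (esym (assoc_nat _ _ _))) -!cmpA.
rewrite (cmp_rewrite _ (triangle _ _)) !cmpA -!whisker_r_cmp zig.
by [].
Qed.

Lemma transp_vanishes (X Y : bhom i j) (x : mor X Y) (u : mor U (star D \c Y)) :
  vanishes x (transp u) <-> vanishes (idm (star D) \h x) u.
Proof.
split=> [[s us]|[s ->]]; last by rewrite transp_nat; apply: vanishes_self.
have := transpK u; rewrite us whisker_l_cmp -!cmpA.
set w := (_ \h s) \v _ => uw.
have {}uw : idm (one k) \h u = assoc (one k) (star D) Y
    \v (ibwd (lunit (star D)) \h idm Y) \v ((idm (star D) \h x) \v w).
  rewrite uw -!cmpA (cmp_rewrite _ (whisker_r_iso _ (iso_bf _))) cmp1m.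
  by rewrite (cmp_rewrite _ (iso_fb _)) cmp1m.
rewrite -(cmpm1 u) -(iso_fb (lunit U)) cmpA -lunit_nat uw -!cmpA.
rewrite (cmp_rewrite _ (interchange _ _)) -!cmpA.
rewrite -(hcmp1 (one k) (star D)) (cmp_rewrite _ (assoc_nat _ _ _)) -!cmpA.
by rewrite (cmp_rewrite _ (lunit_nat _)) -!cmpA; apply: vanishes_self.
Qed.

End Left.

(** One zigzag identity: the transpose of the unit of the adjunction is the
    identity. *)
Lemma transp_coev (i j : C) (F Y : bhom i j) (e : mor F Y) :
  transp ((idm (star F) \h e) \v coev F) = e \v runit F.
Proof.
rewrite transp_nat; congr (_ \v _).
by rewrite -[LHS]cmpm1 -(iso_bf (runit F)) cmpA zigzag1 cmp1m.
Qed.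

Section Right.
Variables (i i' j : C) (h : bhom i i') (F : bhom i j) (Y : bhom i' j).

(** Right composition with [h] is right adjoint to right composition with
    [star h]: the order is opposite to that for left composition, because
    composing on the right reverses the roles of unit and counit. *)
Definition rtransp (v : mor (F \c star h) Y) : mor F (Y \c h) :=
  (v \h idm h) \v ibwd (assoc F (star h) h) \v (idm F \h coev h)
    \v ibwd (runit F).

(** Here too [v] is recovered only up to precomposition with a coherence
    isomorphism, which spares identifying that isomorphism with the identity. *)
Lemma rtranspK (v : mor (F \c star h) Y) :
  runit Y \v (idm Y \h ev h) \v assoc Y h (star h)
    \v (rtransp v \h idm (star h))
  = v \v runit (F \c star h) \v ibwd (assoc F (star h) (one i'))
      \v (idm F \h ibwd (runit (star h))).
Proof.
set H := star h.
have pent : assoc (F \c H) h H \v (ibwd (assoc F H h) \h idm H)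
    = ibwd (assoc F H (h \c H)) \v (idm F \h assoc H h H) \v assoc F (H \c h) H.
  rewrite -[LHS]cmp1m -(iso_bf (assoc F H (h \c H))) -!cmpA.
  rewrite (cmp_rewrite _ (pentagon _ _ _ _)) -!cmpA.
  by rewrite (whisker_r_iso _ (iso_fb _)) cmpm1.
have zig : (idm H \h ev h) \v (assoc H h H \v ((coev h \h idm H)
    \v ibwd (lunit H))) = ibwd (runit H).
  rewrite -[LHS]cmp1m -(iso_bf (runit H)) -!cmpA.
  by have := zigzag2 h; rewrite -!cmpA => ->; rewrite cmpm1.
have tri : assoc F (one i) H \v (ibwd (runit F) \h idm H)
    = idm F \h ibwd (lunit H).
  rewrite -[LHS]cmp1m -(whisker_l_iso F (iso_bf (lunit H))) -!cmpA.
  rewrite (cmp_rewrite _ (triangle _ _)).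
  by rewrite (whisker_r_iso _ (iso_fb _)) cmpm1.
rewrite /rtransp !whisker_r_cmp -!cmpA.
rewrite (cmp_rewrite _ (assoc_nat _ _ _)) hcmp1 -!cmpA.
rewrite (cmp_rewrite _ (esym (interchange _ _))) -!cmpA.
rewrite (cmp_rewrite _ pent) -!cmpA.
rewrite (cmp_rewrite _ (assoc_nat _ _ _)) -!cmpA tri.
rewrite -!whisker_l_cmp -[idm (F \c H)]hcmp1.
rewrite (cmp_rewrite _ (runit_nat _)) -!cmpA; congr (_ \v (_ \v _)).
rewrite (cmp_rewrite _ (esym (assoc_inv_nat _ _ _))) -!cmpA.
by rewrite -whisker_l_cmp zig.
Qed.

Lemma rtransp_vanishes (X : bhom i' j) (x : mor X Y) (v : mor (F \c star h) Y) :
  vanishes (x \h idm h) (rtransp v) -> vanishes x v.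
Proof.
move=> [s vs]; have := rtranspK v; rewrite vs whisker_r_cmp -!cmpA.
rewrite (cmp_rewrite _ (assoc_nat _ _ _)) hcmp1 -!cmpA.
rewrite (cmp_rewrite _ (esym (interchange _ _))) -!cmpA.
rewrite (cmp_rewrite _ (runit_nat _)) -!cmpA.
set t := runit X \v _; set th := runit (F \c _) \v _ => E.
pose th' := (idm F \h runit (star h)) \v assoc F (star h) (one i')
  \v ibwd (runit (F \c star h)).
have thth' : th \v th' = idm (F \c star h).
  rewrite /th /th' -!cmpA (cmp_rewrite _ (whisker_l_iso _ (iso_bf _))) cmp1m.
  by rewrite (cmp_rewrite _ (iso_bf _)) cmp1m iso_fb.
by rewrite -(cmpm1 v) -thth' cmpA -E -cmpA; apply: vanishes_self.
Qed.

End Right.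

End Transpose.

(** * Annihilators of simple tops *)

Section Annihilator.
Variables (K : fieldType) (C : finbicat K).

(** Objects of [C] form a finite type, so the transport in [ann] is along a
    proof equal to reflexivity. *)
Lemma annE (i j l : C) (L : Pbar i j) (A B : bhom j l) (a : mor A B) :
  ann L a <-> vanishes (idm B \h pmap L) (a \h idm (ptgt L)).
Proof.
split=> [/(_ erefl)|[s E] e].
  by move=> [s]; rewrite subr0 => E; exists s.
rewrite (eq_irrelevance e erefl).
by exists s; rewrite subr0.
Qed.

Lemma ann_domain (i j k l : C) (L : Pbar i j) (A B : bhom k l) (a : mor A B) :
  j != k -> ann L a.
Proof. by move=> /eqP jk e. Qed.

Lemma ann_cmp (i j l : C) (L : Pbar i j) (A B B' : bhom j l)
    (a : mor A B) (b : mor B B') : ann L a -> ann L (b \v a).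
Proof.
rewrite !annE => -[s as_]; exists ((b \h idm _) \v s).
by rewrite whisker_r_cmp as_ !cmpA interchange.
Qed.

(** The right action of [h] on presentations commutes with the left action of
    2-morphisms, up to associators. *)
Lemma ann_rcmp (i i' j l : C) (L : Pbar i j) (h : bhom i' i)
    (A B : bhom j l) (a : mor A B) :
  ann L a -> ann (Pres (pmap L \h idm h) : Pbar i' j) a.
Proof.
rewrite !annE => -[s as_] /=.
have -> : a \h idm (ptgt L \c h)
    = assoc B (ptgt L) h \v ((a \h idm _) \h idm h)
        \v ibwd (assoc A (ptgt L) h).
  by rewrite assoc_nat hcmp1 -cmpA iso_fb cmpm1.
rewrite as_ whisker_r_cmp cmpA assoc_nat -!cmpA; exact: vanishes_self.
Qed.

End Annihilator.

Section Fiab.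
Variables (K : fieldType) (C : fiab K).

(** The projection [F -> L], precomposed with [runit F], is the transpose of a
    morphism from the identity 1-morphism to [star F] acting on [L]; that
    object is therefore nonzero. *)
Lemma ann_star_self (i j : C) (F : bhom i j) (L : Pbar i j) :
  is_L F L -> ~ ann L (idm (star F)).
Proof.
move=> /top_cover_ex[e [ne _ _]]; rewrite annE hcmp1 => null.
apply: ne; rewrite -(cmpm1 e) -(iso_fb (runit F)) cmpA; apply: vanishes_cmp.
rewrite -transp_coev transp_vanishes -(cmp1m (_ \v _)).
exact: vanishes_cmp.
Qed.

(** The identity of [star F \c ptgt L] represents the canonical projection to
    [star F] acting on [L]; its transpose is a morphism to [L] from the
    projective object of some [F \c Z]. *)
Lemma leR_ann_star (i i' j : C) (F : bhom i j) (G : bhom i' j) (L : Pbar i' j) :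
  indecomposable G -> is_L G L -> ~ ann L (idm (star F)) -> leR F G.
Proof.
move=> iG GL; rewrite annE hcmp1 => nz.
apply: (@LeR _ _ _ _ _ _ (star F \c ptgt L)).
apply: (top_summand (v := transp (idm (star F \c ptgt L))) iG GL).
by rewrite transp_vanishes.
Qed.

(** Every 1-morphism is isomorphic to its double star, hence is a right adjoint;
    this is used for [B], on the left, and for [H], on the right. *)
Lemma leR_ann (i i' j l : C) (F : bhom i j) (G : bhom i' j) (H : bhom i' i)
    (LF : Pbar i j) (LG : Pbar i' j) (A B : bhom j l) (a : mor A B) :
  indecomposable F -> is_L F LF -> is_L G LG ->
  summand G (F \c H) -> ann LG a -> ann LF a.
Proof.
move=> iF /top_cover_ex[e cov_e] /top_cover_ex[e' [ne' _ _]].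
move=> [_ [i1 [_ [p1 [_ [p1i1 _ _ _ _]]]]]] LGa.
pose h := star H; pose D := star B.
pose v := e' \v p1 \v (idm F \h ibwd (sinv H)).
pose f := rtransp v : mor F (ptgt LG \c h).
pose M := Pres (pmap LG \h idm h) : Pbar i j.
have nf : ~ vanishes (pmap M) f.
  move=> /rtransp_vanishes v0; apply: ne'; rewrite -(cmpm1 e') -p1i1.
  rewrite -(cmp1m i1) -(whisker_l_iso F (iso_bf (sinv H))) !cmpA.
  by do 2!apply: vanishes_cmp.
pose a' := sinv B \v a.
have LFa' : ann LF a' -> ann LF a.
  by move/(ann_cmp (ibwd (sinv B))); rewrite cmpA iso_bf cmp1m.
apply/LFa'/annE.
have Ma' : ann M a' by apply/ann_cmp/ann_rcmp.
pose u : mor (A \c F) (star D \c F) := a' \h idm F.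
have fu0 : vanishes (pmap M) (f \v transp u).
  rewrite -transp_nat transp_vanishes /u -interchange; apply: vanishes_cmp.
  exact/annE.
have := top_cover_max iF cov_e nf fu0.
rewrite -transp_nat transp_vanishes /u -interchange => ae0.
(* It remains to descend from [F] to its quotient [LF]: the identity of       *)
(* [ptgt LF] factors through [e] modulo [pmap LF].                            *)
have [_ [s [t st]] _] := cov_e.
have idY : idm (ptgt LF) = (-1) *: (pmap LF \v t) + e \v s.
  by rewrite -st scaleN1r opprB subrK.
rewrite idY hcmp_linr; apply: vanishesD.
  by apply: vanishesZ; rewrite -(cmp1m a') hcmp_v; apply: vanishes_self.
rewrite -(cmpm1 a') hcmp_v; apply: vanishes_cmp.
by rewrite -hcmp_v cmpm1 cmp1m in ae0.
Qed.

End Fiab.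

Theorem theorem18 (R : realType) (C : fiab (complex R))
  (i j i' j' : C) (F : bhom i j) (G : bhom i' j')
  (F_indec : indecomposable F) (G_indec : indecomposable G)
  (L_F : Pbar i j) (L_G : Pbar i' j')
  (L_F_top : is_L F L_F) (L_G_top : is_L G L_G) :
  leR F G <->
  (forall (k l : C) (A B : bhom k l) (a : mor A B), ann L_G a -> ann L_F a).
Proof.
split=> [FG | JGF].
  case: FG G_indec L_G L_G_top => H {}G FHG G_indec L_G L_G_top k l A B a aG e.
  by subst k; apply: (leR_ann F_indec L_F_top L_G_top FHG aG).
have nF := ann_star_self L_F_top.
have [jj'|jj'] := eqVneq j' j; last by case: nF; apply/JGF/ann_domain.
subst j'; apply: (leR_ann_star G_indec L_G_top) => G0.
exact/nF/JGF.
Qed.
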